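(* Let $E$ be a row-finite directed graph with no sources and let $R$ be an integral domain with identity. Let $n\in N(E)$ and let $x\in s(\operatorname{supp}(n))$. Then (1) $\operatorname{supp}(n)\operatorname{supp}(n)^{-1}\cup \operatorname{supp}(n)^{-1}\operatorname{supp}(n)\subset \operatorname{Iso}(G_E):=\{g\in G_E: r(g)=s(g)\}$; (2) $r(\operatorname{supp}(n)x)$ is a singleton.
   Context: A directed graph $E=(E^0,E^1,r,s)$ consists of countable sets $E^0$ (vertices), $E^1$ (edges) and maps $r,s:E^1\to E^0$. It is row-finite if $r^{-1}(v)$ is finite for every $v\in E^0$, and has no sources if $r^{-1}(v)\neq\emptyset$ for every $v$. Paths are sequences of edges $\mu=\mu_1\mu_2\cdots$ with $s(\mu_i)=r(\mu_{i+1})$; $P(E)$ is the set of finite paths (vertices are paths of length $0$, with $r(v)=s(v)=v$), $|\mu|$ is the length of $\mu\in P(E)$, $r(\mu)=r(\mu_1)$, $s(\mu)=s(\mu_{|\mu|})$, and $E^\infty$ is the set of infinite paths. Graph groupoid: $G_E$ is the set of triples $(x,k,y)\in E^\infty\times\mathbb{Z}\times E^\infty$ such that there are $\mu,\nu\in P(E)$ and $z\in E^\infty$ with $x=\mu z$, $y=\nu z$, $k=|\mu|-|\nu|$; $r(x,k,y)=x$, $s(x,k,y)=y$, $(x,k,y)(y,l,z)=(x,k+l,z)$, $(x,k,y)^{-1}=(y,-k,x)$, and $x\in E^\infty$ is identified with the unit $(x,0,x)$. For $\mu,\nu\in P(E)$ with $s(\mu)=s(\nu)$ put $Z(\mu,\nu)=\{(\mu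 z,|\mu|-|\nu|,\nu z): z\in E^\infty, r(z)=s(\mu)\}$; these sets form a basis for the (Hausdorff) topology of $G_E$, and are compact. $Z(\mu)=\{\mu z\}$ is identified with $Z(\mu,\mu)$. For $B,C\subset G_E$: $BC=\{\gamma\eta:\gamma\in B,\eta\in C,s(\gamma)=r(\eta)\}$, $B^{-1}=\{\gamma^{-1}:\gamma\in B\}$, and for $x\in E^\infty$, $Bx=\{\gamma\in B:s(\gamma)=x\}$. The integral domain $R$ has an involution $r\mapsto\overline r$ (a ring automorphism with $\overline{\overline r}=r$). The Leavitt path algebra $L_R(E)$ is viewed as the Steinberg algebra of $G_E$: the $R$-span of the characteristic functions $\mathbf 1_{Z(\mu,\nu)}:G_E\to R$, with convolution product $f*g(\gamma)=\sum_{r(\eta)=r(\gamma)}f(\eta)g(\eta^{-1}\gamma)$ (also written $fg$) and involution $f^*(\gamma)=\overline{f(\gamma^{-1})}$. $\operatorname{supp}(f)=\{\gamma:f(\gamma)\neq0\}$. The diagonal is $D(E)=\operatorname{span}_R\{\mathbf 1_{Z(\mu)}:\mu\in P(E)\}$. An element $n\in L_R(E)$ is a normalizer of $D(E)$ if $ndn^*,\,n^*dn\in D(E)$ for all $d\in D(E)$; $N(E)$ is the set of normalizers. *)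

(* Defs.v *)
From HB Require Import structures.
From mathcomp Require Import all_boot all_order all_algebra.
From mathcomp Require Import boolp classical_sets functions cardinality fsbigop.
From mathcomp Require Import numfun.

Set Implicit Arguments.
Unset Strict Implicit.
Unset Printing Implicit Defensive.

Import GRing.Theory.
Local Open Scope classical_set_scope.
Local Open Scope ring_scope.

Record digraph := Digraph {
  vertex : countType;
  edge : countType;
  erng : edge -> vertex;
  esrc : edge -> vertex }.

Definition row_finite (E : digraph) : Prop :=
  forall v : vertex E, finite_set (@erng E @^-1` [set v]).

Definition no_sources (E : digraph) : Prop :=
  forall v : vertex E, @erng E @^-1` [set v] !=set0.

Section Paths.
Variable E : digraph.

Definition composable : rel (edge E) := fun e f => esrc e == erng f.

(* The range vertex is recorded next to the list of edges so that each vertex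
   is a path of length 0; for a nonempty list it is the range of the head. *)
Record fpath := FPath {
  fprng : vertex E;
  fpedges : seq (edge E);
  _ : (if fpedges is e :: _ then fprng == erng e else true)
      && sorted composable fpedges }.

Definition fplen (mu : fpath) : nat := size (fpedges mu).

Definition fpsrc (mu : fpath) : vertex E :=
  last (fprng mu) (map (@esrc E) (fpedges mu)).

Record ipath := IPath {
  ipedge :> nat -> edge E;
  ipedgeP : forall i, esrc (ipedge i) = erng (ipedge i.+1) }.

Definition iprng (x : ipath) : vertex E := erng (x 0%N).

HB.instance Definition _ := gen_eqMixin ipath.
HB.instance Definition _ := gen_choiceMixin ipath.

Definition scat (l : seq (edge E)) (z : nat -> edge E) : nat -> edge E :=
  fun i => if (i < size l)%N then nth (z 0%N) l i else z (i - size l)%N.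

(* x = mu z, where mu z is only defined when s(mu) = r(z) *)
Definition is_concat (mu : fpath) (z x : ipath) : Prop :=
  fpsrc mu = iprng z /\ forall i, x i = scat (fpedges mu) z i.

Definition in_groupoid (t : ipath * int * ipath) : Prop :=
  exists (mu nu : fpath) (z : ipath),
    [/\ is_concat mu z t.1.1, is_concat nu z t.2 &
        t.1.2 = (fplen mu)%:Z - (fplen nu)%:Z].

Record groupoid := GElt {
  gval : ipath * int * ipath;
  _ : `[< in_groupoid gval >] }.

HB.instance Definition _ := [isSub for gval].
HB.instance Definition _ := [Choice of groupoid by <:].

Definition grng (g : groupoid) : ipath := (gval g).1.1.
Definition gdeg (g : groupoid) : int := (gval g).1.2.
Definition gsrc (g : groupoid) : ipath := (gval g).2.

Lemma ginv_subproof (g : groupoid) :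
  `[< in_groupoid (gsrc g, - gdeg g, grng g) >].
Proof.
have /asboolP[mu [nu [z [h1 h2 h3]]]] := valP g.
apply/asboolP; exists nu, mu, z; split => //=.
by rewrite /gdeg h3 opprB.
Qed.

Definition ginv (g : groupoid) : groupoid := GElt (ginv_subproof g).

(* insubd makes the product total; on composable pairs, the only ones on which
   it is used, gmulE below shows that the default value g is not reached. *)
Definition gmul (g h : groupoid) : groupoid :=
  insubd g (grng g, gdeg g + gdeg h, gsrc h).

Definition ipshift (n : nat) (x : ipath) : ipath :=
  @IPath (fun i => x (n + i)%N)
         (fun i => eq_ind _ (fun m => esrc (x (n + i)%N) = erng (x m))
                    (ipedgeP x (n + i)) _ (esym (addnS n i))).

Lemma fptake_subproof (n : nat) (x : ipath) :
  (if mkseq x n is e :: _ then iprng x == erng e else true)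
  && sorted composable (mkseq x n).
Proof.
apply/andP; split; first by case: n => //= n; rewrite eqxx.
case: n => [|n] //; apply/(pathP (x 0%N)) => i.
rewrite size_map size_iota => hi.
rewrite /composable; have := ipedgeP x i.
have -> : nth (x 0%N) (x 0%N :: [seq x i | i <- iota 1 n]) i = x i.
  by rewrite -[_ :: _]/(mkseq x n.+1) nth_mkseq // ltnW.
have -> : nth (x 0%N) [seq x i | i <- iota 1 n] i = x i.+1.
  by rewrite (nth_map 0%N) ?size_iota // nth_iota.
by move=> ->.
Qed.

Definition fptake (n : nat) (x : ipath) : fpath := FPath (fptake_subproof n x).

Lemma fplen_take n x : fplen (fptake n x) = n.
Proof. by rewrite /fplen /= size_mkseq. Qed.

Lemma is_concat_take n (x z : ipath) :
  (forall i, x (n + i)%N = z i) -> is_concat (fptake n x) z x.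
Proof.
move=> h; split=> [|i].
  rewrite /fpsrc /iprng -(h 0%N) addn0; case: n h => [|n] h //.
  by rewrite [fpedges _]mkseqS map_rcons last_rcons ipedgeP.
rewrite /scat /= size_mkseq; case: ltnP => hi; first by rewrite nth_mkseq.
by rewrite -h subnKC.
Qed.

Lemma in_groupoidP (t : ipath * int * ipath) :
  in_groupoid t <-> exists a b : nat,
    t.1.2 = a%:Z - b%:Z /\ forall i, t.1.1 (a + i)%N = t.2 (b + i)%N.
Proof.
case: t => -[x k] y /=; split.
  move=> [mu [nu [z [/= [_ h1] [_ h2] ->]]]].
  exists (fplen mu), (fplen nu); split=> // i.
  by rewrite h1 h2 /scat !ltnNge !leq_addr /= !addKn.
move=> [a [b [-> h]]].
exists (fptake a x), (fptake b y), (ipshift a x); split=> /=.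
- exact: is_concat_take.
- by apply: is_concat_take => i /=; rewrite h.
- by rewrite !fplen_take.
Qed.

Lemma gmulE (g h : groupoid) : gsrc g = grng h ->
  gval (gmul g h) = (grng g, gdeg g + gdeg h, gsrc h).
Proof.
move=> e; apply: insubdK; apply/asboolP/in_groupoidP => /=.
have /asboolP/in_groupoidP[a [b [hk h1]]] := valP g.
have /asboolP/in_groupoidP[c [d [hl h2]]] := valP h.
exists (a + c)%N, (b + d)%N; split.
  by rewrite /gdeg hk hl !PoszD opprD addrACA.
move=> i; rewrite -addnA [LHS]h1 -[(val g).2]/(gsrc g) e addnCA [LHS]h2.
by rewrite addnCA addnA.
Qed.

Definition Iso : set groupoid := [set g | grng g = gsrc g].

Definition set_gmul (B C : set groupoid) : set groupoid :=
  [set k | exists g h, [/\ B g, C h, gsrc g = grng h & k = gmul g h]].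

Definition set_ginv (B : set groupoid) : set groupoid := ginv @` B.

Definition gfiber (B : set groupoid) (x : ipath) : set groupoid :=
  [set g | B g /\ gsrc g = x].

Definition Zset (mu nu : fpath) : set groupoid :=
  [set g | exists z : ipath,
     [/\ is_concat mu z (grng g), is_concat nu z (gsrc g) &
         gdeg g = (fplen mu)%:Z - (fplen nu)%:Z]].

End Paths.

Section LeavittPathAlgebra.
Variables (E : digraph) (R : idomainType) (bar : {rmorphism R -> R}).

Definition lspan (S : set (groupoid E -> R)) : set (groupoid E -> R) :=
  [set f | exists (m : nat) (c : 'I_m -> R) (h : 'I_m -> groupoid E -> R),
     (forall i, S (h i)) /\ forall g, f g = \sum_(i < m) c i * h i g].

Definition leavitt : set (groupoid E -> R) :=
  lspan [set f | exists mu nu : fpath E,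
           fpsrc mu = fpsrc nu /\ f = \1_(Zset mu nu)].

(* Z(mu) is identified with Z(mu,mu). *)
Definition diagonal : set (groupoid E -> R) :=
  lspan [set f | exists mu : fpath E, f = \1_(Zset mu mu)].

(* \sum_(_ \in _) only sums over a finite support; for f in the Leavitt path
   algebra and fixed g, finitely many terms are nonzero. *)
Definition conv (f f' : groupoid E -> R) : groupoid E -> R :=
  fun g => \sum_(h \in [set h | grng h = grng g]) f h * f' (gmul (ginv h) g).

Definition star (f : groupoid E -> R) : groupoid E -> R :=
  fun g => bar (f (ginv g)).

Definition supp (f : groupoid E -> R) : set (groupoid E) :=
  [set g | f g != 0].

Definition normalizer : set (groupoid E -> R) :=
  [set n | leavitt n /\ forall d, diagonal d ->
     diagonal (conv (conv n d) (star n)) /\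
     diagonal (conv (conv (star n) d) n)].

End LeavittPathAlgebra.

(* Main.v *)
Require Import Defs.
From mathcomp Require Import all_boot all_order all_algebra.
From mathcomp Require Import boolp classical_sets functions cardinality fsbigop.
From mathcomp Require Import numfun.

(** Let [f] be a normalizer, [y] an infinite path, and let [1_Z(mu)] run
    through the cylinders of the initial segments [mu] of [y].  For given [g]
    with range [a], the value of [f * 1_Z(mu) * f^*] at [g] is a finite sum over
    the [h] with range [a] and source in [Z(mu)], because the support of an
    element of the Leavitt path algebra meets each range fibre in a finite set.
    Once [mu] is long enough to separate [y] from the finitely many other
    sources involved, only the [h = (a, l, y)] are left.  For [g = (a, k, b)]
    with [a <> b] the sum must vanish, since diagonal functions live on units;
    that is, for all [k],
      [\sum_l f (a, l, y) * bar (f (b, l - k, y)) = 0].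

    These sums are the coefficients of the product of the Laurent polynomials
    [\sum_l f (a, l, y) t^l] and [\sum_l bar (f (b, l, y)) t^-l].  As [R] is a
    domain, one of the two is zero: if both were nonzero, the product of their
    leading coefficients, obtained for [k] the largest [l] in the first minus
    the smallest [l] in the second, would be nonzero.  So two elements of
    [supp f] with the same source have the same range
    ([normalizer_rng_determined_by_src]).

    Everything else is formal: this property of [n] gives the inclusion for
    [supp n (supp n)^-1] and the uniqueness of the range, and the same property of
    [n^*], which is a normalizer too, gives the inclusion for
    [(supp n)^-1 supp n]. *)

Set Implicit Arguments.
Unset Strict Implicit.
Unset Printing Implicit Defensive.

Import Order.TTheory GRing.Theory Num.Theory.
Local Open Scope classical_set_scope.
Local Open Scope ring_scope.

(** * Finite sets *)

Lemma finite_subsingleton (T : Type) (A : set T) :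
  (forall a b, A a -> A b -> a = b) -> finite_set A.
Proof.
move=> Asub; have [->|/set0P[a Aa]] := eqVneq A set0; first exact: finite_set0.
by apply: sub_finite_set (finite_set1 a) => b Ab; apply: Asub.
Qed.

Lemma finite_set_max (T : choiceType) (A : set T) (d : T -> int) :
  finite_set A -> A !=set0 ->
  exists a, A a /\ forall b, A b -> d b <= d a.
Proof.
move=> /finite_seqP[s ->]; elim: s => [[? //]|c s IHs _].
have [sE|[a sa]] : s = [::] \/ [set` s] !=set0.
- by case: (s) => [|a s']; [left|right; exists a; rewrite /= mem_head].
- exists c; split=> [|b]; first by rewrite /= mem_head.
  by rewrite /= sE inE => /eqP ->.
have [{sa}a [sa amax]] := IHs (ex_intro _ a sa).
have [le_ca|lt_ac] := leP (d c) (d a).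
  exists a; split=> [|b] /=; first by rewrite inE sa orbT.
  by rewrite inE => /orP[/eqP->//|/amax].
exists c; split=> [|b] /=; first by rewrite mem_head.
by rewrite inE => /orP[/eqP->//|/amax/le_trans->//]; apply: ltW.
Qed.

(** * Infinite paths and groupoid elements *)

Section Groupoid.
Variable E : digraph.
Implicit Types (x y z : ipath E) (g h : groupoid E) (mu nu : Defs.fpath E).

Lemma ipath_ext x y : (forall i, x i = y i) -> x = y.
Proof.
case: x y => [x xP] [y yP] /= xy; have {}xy : x = y by apply/funext.
by case: y / xy yP => yP; congr IPath; apply: Prop_irrelevance.
Qed.

Lemma groupoid_ext g h :
  grng g = grng h -> gdeg g = gdeg h -> gsrc g = gsrc h -> g = h.
Proof.
case: g h => [[[x k] y] gP] [[[x' k'] y'] hP].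
rewrite /grng /gdeg /gsrc /= => ? ? ?; apply: val_inj => /=.
by congr (_, _, _).
Qed.

Lemma ginvK : involutive (@ginv E).
Proof. by move=> g; apply: groupoid_ext => //; apply: opprK. Qed.

Lemma is_concat_tail_inj mu z z' x :
  is_concat mu z x -> is_concat mu z' x -> z = z'.
Proof.
move=> [_ xE] [_ xE']; apply: ipath_ext => i.
have := xE (fplen mu + i)%N; rewrite xE' /scat ltnNge leq_addr /= addKn.
by move->.
Qed.

Lemma is_concat_inj mu z x x' :
  is_concat mu z x -> is_concat mu z x' -> x = x'.
Proof. by move=> [_ xE] [_ xE']; apply: ipath_ext => i; rewrite xE xE'. Qed.

Lemma Zset_rng_inj mu nu g h :
  Zset mu nu g -> Zset mu nu h -> grng g = grng h -> g = h.
Proof.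
move=> [z [gr gs gd]] [z' [hr hs hd]] gh.
have zz' : z = z' by apply: is_concat_tail_inj gr _; rewrite gh.
apply: groupoid_ext => //; first by rewrite gd hd.
by apply: is_concat_inj gs _; rewrite zz'.
Qed.

Lemma Zset_ginv mu nu g : Zset mu nu g -> Zset nu mu (ginv g).
Proof. by move=> [z [gr gs gd]]; exists z; split=> //; rewrite -opprB -gd. Qed.

Lemma Zset_src_inj mu nu g h :
  Zset mu nu g -> Zset mu nu h -> gsrc g = gsrc h -> g = h.
Proof.
move=> /Zset_ginv gZ /Zset_ginv hZ gh.
exact/(can_inj ginvK)/(Zset_rng_inj gZ hZ gh).
Qed.

Lemma Zset_diag_unit mu g : Zset mu mu g -> grng g = gsrc g /\ gdeg g = 0.
Proof.
move=> [z [gr gs ->]]; rewrite subrr; split=> //.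
exact: is_concat_inj gr gs.
Qed.

Lemma grng_gmul g h : gsrc g = grng h -> grng (gmul g h) = grng g.
Proof. by move=> /gmulE e; rewrite /grng e. Qed.

Lemma gsrc_gmul g h : gsrc g = grng h -> gsrc (gmul g h) = gsrc h.
Proof. by move=> /gmulE e; rewrite {1}/gsrc e. Qed.

Lemma gdeg_gmul g h : gsrc g = grng h -> gdeg (gmul g h) = gdeg g + gdeg h.
Proof. by move=> /gmulE e; rewrite {1}/gdeg e. Qed.

Lemma is_concat_fptake_prefix N y z x :
  is_concat (fptake N y) z x -> forall i, (i < N)%N -> x i = y i.
Proof.
by move=> [_ xE] i iN; rewrite xE /scat /= size_mkseq iN nth_mkseq.
Qed.

(** The path space is Hausdorff, with the cylinders of the initial segments of
    [y] as neighbourhoods of [y]. *)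
Lemma prefix_separates (A : set (ipath E)) y : finite_set A ->
  exists N, forall x, A x -> (forall i, (i < N)%N -> x i = y i) -> x = y.
Proof.
move=> /finite_seqP[s ->]; elim: s => [|x0 s [N IHs]]; first by exists 0%N.
have [->|xNy] := EM (x0 = y).
  by exists N => x /=; rewrite inE => /orP[/eqP->//|]; apply: IHs.
have [j xj] : exists j, x0 j <> y j.
  by apply/existsNP => xy; apply/xNy/ipath_ext.
exists (maxn N j.+1) => x /=; rewrite inE => /orP[/eqP->|xs] xE.
  by case: xj; apply: xE; rewrite leq_maxr.
by apply: IHs => // i iN; apply: xE; rewrite leq_max iN.
Qed.

Lemma Zset_fptake_unit N x g :
  gdeg g = 0 -> grng g = x -> gsrc g = x -> Zset (fptake N x) (fptake N x) g.
Proof.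
move=> gd gr gs; exists (ipshift N x).
by rewrite gd gr gs subrr; split=> //; apply: is_concat_take.
Qed.

End Groupoid.

(** * Convolution with diagonal functions *)

Section Algebra.
Variables (E : digraph) (R : idomainType) (bar : {rmorphism R -> R}).
Implicit Types (f : groupoid E -> R) (g h : groupoid E) (mu : Defs.fpath E).

Lemma lspan_supp (S : set (groupoid E -> R)) f g :
  lspan S f -> f g != 0 -> exists2 u, S u & u g != 0.
Proof.
move=> [m [c [u [Su fE]]]]; rewrite fE => sum_neq0.
apply: contrapT => noS; move/eqP: sum_neq0; apply.
apply: big1 => i _; suff -> : u i g = 0 by rewrite mulr0.
by apply/eqP; apply: contrapT => /negP ug; apply: noS; exists (u i).
Qed.

Lemma indic_neq0 (A : set (groupoid E)) g : (\1_A g : R) != 0 -> A g.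
Proof.
by rewrite indicE; case: (boolP (g \in A)) => [/set_mem//|_]; rewrite eqxx.
Qed.

Lemma diagonal_supp_Iso (d : groupoid E -> R) g :
  Defs.diagonal d -> d g != 0 -> grng g = gsrc g.
Proof.
move=> dD dg; have [_ [mu ->] /indic_neq0/Zset_diag_unit[]//] := lspan_supp dD dg.
Qed.

Lemma diagonal_indic mu : Defs.diagonal (\1_(Zset mu mu) : groupoid E -> R).
Proof.
exists 1%N, (fun=> 1), (fun=> \1_(Zset mu mu)); split; first by move=> _; exists mu.
by move=> g; rewrite big_ord1 mul1r.
Qed.

(** To be used with [p] the range or the source map: each basic set [Z(mu, nu)]
    is the graph of a partial bijection from sources to ranges, so it meets
    every fibre of [p] in at most one point, and an element of the algebra is
    supported on finitely many such sets. *)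
Lemma leavitt_finite_fiber (p : groupoid E -> ipath E) f (a : ipath E) :
  (forall mu nu g h, Zset mu nu g -> Zset mu nu h -> p g = p h -> g = h) ->
  leavitt f -> finite_set [set h | supp f h /\ p h = a].
Proof.
move=> p_inj [m [c [u [uZ fE]]]].
apply: (@sub_finite_set _ _
  (\bigcup_(i in [set: 'I_m]) [set h | u i h != 0 /\ p h = a])).
  move=> h [hf ha]; apply: contrapT => noU; move/eqP: hf; apply.
  rewrite fE; apply: big1 => i _; have [->|uh] := eqVneq (u i h) 0.
    by rewrite mulr0.
  by case: noU; exists i.
apply: bigcup_finite => [|i _]; first exact: finite_finset.
have [mu [nu [_ ->]]] := uZ i.
apply: finite_subsingleton => g h [/indic_neq0 gZ <-] [/indic_neq0 hZ /esym].
exact: p_inj gZ hZ.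
Qed.

Lemma fsbig_single (A : set (groupoid E)) (F : groupoid E -> R) h0 :
  A h0 -> (forall h, A h -> h <> h0 -> F h = 0) ->
  \sum_(h \in A) F h = F h0.
Proof.
move=> Ah0 F0; rewrite -(@fsbig_widen _ _ _ _ [set h0] A F) ?fsbig_set1//.
  by move=> _ ->.
by move=> h [/= Ah hNh0]; apply: F0.
Qed.

Lemma conv_indic_diag f mu h :
  conv f \1_(Zset mu mu) h = f h * \1_(Zset mu mu) (gmul (ginv h) h).
Proof.
apply: fsbig_single => // k kh kNh; rewrite indicE.
case: (boolP (_ \in _)) => [/set_mem/Zset_diag_unit[]|_]; last by rewrite mulr0.
have e : gsrc (ginv k) = grng h by [].
rewrite grng_gmul// gsrc_gmul// gdeg_gmul// => rs.
move=> /eqP; rewrite addrC subr_eq0 => /eqP deg.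
by case: kNh; apply: groupoid_ext.
Qed.

(** Only one of the two normalizer conditions is assumed of [f], so that the
    lemma applies to a normalizer and to its adjoint alike.  In the proof, [k1]
    and [k2] carry the leading coefficients of the two Laurent polynomials, and
    the value at [k1 k2^-1] is the product of these coefficients. *)
Lemma normalizer_rng_determined_by_src f (h1 h2 : groupoid E) :
  injective bar ->
  (forall a, finite_set [set h | supp f h /\ grng h = a]) ->
  (forall d, Defs.diagonal d -> Defs.diagonal (conv (conv f d) (star bar f))) ->
  supp f h1 -> supp f h2 -> gsrc h1 = gsrc h2 -> grng h1 = grng h2.
Proof.
move=> bar_inj fin fD; set y := gsrc h1 => sh1 sh2 h12.
apply: contrapT => ab.
pose fib a := [set h | supp f h /\ grng h = a].
pose P a := [set h | fib a h /\ gsrc h = y].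
have Pfin a : finite_set (P a) by apply: sub_finite_set (fin a) => h [].
have [k1 [[[sk1 rk1] ek1] max1]] : exists k, P (grng h1) k /\
    forall h, P (grng h1) h -> gdeg h <= gdeg k.
  by apply: finite_set_max => //; exists h1.
have [k2 [[[sk2 rk2] ek2] min2]] : exists k, P (grng h2) k /\
    forall h, P (grng h2) h -> - gdeg h <= - gdeg k.
  by apply: (@finite_set_max _ _ (fun h => - gdeg h)) => //; exists h2.
have [N sepN] : exists N, forall x, (@gsrc E @` fib (grng h1)) x ->
    (forall i, (i < N)%N -> x i = y i) -> x = y.
  exact/prefix_separates/finite_image/fin.
pose mu := fptake N y; pose g := gmul k1 (ginv k2).
have k12 : gsrc k1 = grng (ginv k2) by rewrite ek1 -ek2.
have rg : grng g = grng h1 by rewrite grng_gmul.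
have sg : gsrc g = grng h2 by rewrite gsrc_gmul.
have dg : gdeg g = gdeg k1 - gdeg k2 by rewrite gdeg_gmul.
have conv0 : conv (conv f \1_(Zset mu mu)) (star bar f) g = 0.
  apply/eqP; apply: contrapT => /negP.
  by move=> /(diagonal_supp_Iso (fD _ (diagonal_indic mu))); rewrite rg sg.
suff convE : conv (conv f \1_(Zset mu mu)) (star bar f) g = f k1 * bar (f k2).
  move: conv0; rewrite convE => /eqP; rewrite mulf_eq0 (negPf sk1) /=.
  by rewrite (raddf_eq0 _ bar_inj) (negPf sk2).
transitivity (conv f \1_(Zset mu mu) k1 *
              star bar f (gmul (ginv k1) g)); last first.
- rewrite conv_indic_diag /star.
  have kk : gsrc (ginv k1) = grng k1 by [].
  have -> : \1_(Zset mu mu) (gmul (ginv k1) k1) = 1 :> R.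
    rewrite indicE mem_set//; apply: Zset_fptake_unit.
    + by rewrite gdeg_gmul// addNr.
    + by rewrite grng_gmul.
    + by rewrite gsrc_gmul.
  rewrite mulr1; congr (_ * bar (f _)).
  have kg : gsrc (ginv k1) = grng g by rewrite rg -rk1.
  apply: groupoid_ext.
  + by rewrite -[LHS]/(gsrc (gmul (ginv k1) g)) gsrc_gmul// sg rk2.
  + rewrite -[LHS]/(- gdeg (gmul (ginv k1) g)) gdeg_gmul// dg.
    by rewrite -[gdeg (ginv k1)]/(- gdeg k1) addKr opprK.
  + by rewrite -[LHS]/(grng (gmul (ginv k1) g)) grng_gmul// ek2 -ek1.
apply: fsbig_single => [|h /= rh hNk1]; first by rewrite /= rg.
rewrite conv_indic_diag indicE.
have [->|sh] := eqVneq (f h) 0; first by rewrite !mul0r.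
case: (boolP (_ \in _)) => [/set_mem hZ|_]; last by rewrite mulr0 mul0r.
have hh : gsrc (ginv h) = grng h by [].
have hy : gsrc h = y.
  case: hZ => z [_]; rewrite gsrc_gmul// => /is_concat_fptake_prefix zy _.
  by apply: sepN zy; exists h => //; split=> //; rewrite rh.
have hg : gsrc (ginv h) = grng g by rewrite -rh.
rewrite mulr1 /star; set h' := ginv _.
have [->|sh'] := eqVneq (f h') 0; first by rewrite rmorph0 mulr0.
(* A nonzero term needs [gdeg h <= gdeg k1] and [gdeg h' >= gdeg k2], where
   [gdeg h' = gdeg k2 - (gdeg k1 - gdeg h)]: only [h = k1] is possible. *)
have dh : gdeg h <= gdeg k1 by apply: max1; split=> //; split=> //; rewrite rh.
have rh' : grng h' = grng h2.
  by rewrite -[LHS]/(gsrc (gmul (ginv h) g)) gsrc_gmul.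
have eh' : gsrc h' = y by rewrite -[LHS]/(grng (gmul (ginv h) g)) grng_gmul.
have := min2 h' (conj (conj sh' rh') eh').
rewrite -[gdeg h']/(- gdeg (gmul (ginv h) g)) gdeg_gmul// dg opprK.
rewrite -[gdeg (ginv h)]/(- gdeg h) addrA gerDr addrC subr_le0 => dk.
case: hNk1; apply: groupoid_ext.
- by rewrite rh rg.
- by apply/eqP; rewrite eq_le dh.
- by rewrite hy.
Qed.

End Algebra.

Theorem proposition3p3 (E : digraph) (R : idomainType)
    (bar : {rmorphism R -> R}) (barK : involutive bar)
    (hfin : row_finite E) (hsrc : no_sources E)
    (n : groupoid E -> R) (hn : normalizer bar n)
    (x : ipath E) (hx : (@gsrc E @` supp n) x) :
  (set_gmul (supp n) (set_ginv (supp n))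
     `|` set_gmul (set_ginv (supp n)) (supp n) `<=` @Iso E) /\
  (exists y : ipath E, @grng E @` gfiber (supp n) x = [set y]).
Proof.
have bar_inj := can_inj barK.
have [nL nD] := hn.
have n_inj h1 h2 : supp n h1 -> supp n h2 ->
    gsrc h1 = gsrc h2 -> grng h1 = grng h2.
  apply: (normalizer_rng_determined_by_src bar_inj) => [a|d /nD[]//].
  exact: leavitt_finite_fiber (@Zset_rng_inj E) nL.
have starK : star bar (star bar n) = n.
  by apply/funext => g; rewrite /star barK ginvK.
have supp_star h : supp (star bar n) h <-> supp n (ginv h).
  by rewrite /supp /= /star (raddf_eq0 _ bar_inj).
have nstar_inj h1 h2 : supp n h1 -> supp n h2 ->
    grng h1 = grng h2 -> gsrc h1 = gsrc h2.
  move=> s1 s2.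
  apply: (@normalizer_rng_determined_by_src _ _ _ (star bar n) (ginv h1)
            (ginv h2) bar_inj) => [a|d /nD[_]||]; last 2 first.
  - by apply/supp_star; rewrite ginvK.
  - by apply/supp_star; rewrite ginvK.
  - apply: sub_finite_set (finite_image (@ginv E)
      (leavitt_finite_fiber a (@Zset_src_inj E) nL)) => h [/supp_star sh ha].
    by exists (ginv h); rewrite ?ginvK.
  - by rewrite starK.
split.
  move=> _ [|] [g [h [+ + gh ->]]].
    move=> sg [k sk kh]; move: gh; rewrite -kh => gk.
    by rewrite /Iso /= grng_gmul// gsrc_gmul//; apply: n_inj.
  move=> [k sk kg] sh; move: gh; rewrite -kg => kh.
  by rewrite /Iso /= grng_gmul// gsrc_gmul//; apply: nstar_inj.
have [h sh hx'] := hx; exists (grng h); apply/seteqP; split=> [_ [k [sk kx] <-]|_ ->].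
  by apply: n_inj => //; rewrite kx.
by exists h.
Qed.
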